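(* Let $B$ be a factorial affine $\mathbb{C}$-domain with an irreducible locally nilpotent derivation $\delta$ such that $A=\ker\delta$ is an affine $\mathbb{C}$-domain, and suppose $\delta(B)\cap A=f^pA$ with $f$ a prime element of $A$ and $p>0$. Let $z\in B$ with $\delta(z)=f^p$, and let $A[z]=B_0\subset B_1\subset B_2\subset\cdots\subset B$ be the sequence of rings obtained by the inductive construction described in the context. Then there exists a positive integer $\nu$ such that $B_\nu=B$.
   Context: Ground field $\mathbb{C}$. An affine $\mathbb{C}$-domain is a finitely generated $\mathbb{C}$-algebra that is a domain; factorial means UFD; $Q(R)$ is the quotient field of a domain $R$. A locally nilpotent derivation $\delta$ on $B$ is irreducible if $\delta(B)\subset bB$ implies $b\in B^*$. For a subdomain $R\subset B$, an ideal $I$ of $R$ and $0\ne h\in I$, $R[h^{-1}I]$ is the subalgebra of $Q(R)$ generated over $R$ by the elements $a/h$, $a\in I$. General notation. $\overline A=A/fA$. For the rings $B_j$ below put $I_{j,k}=B_j\cap f^kB$ for $k\ge1$; $I_{j,1}$ is a prime ideal of $B_j$; $\overline I_{j,1}$ is the image of $I_{j,1}$ in $B_j/fB_j$; $\overline B_j=B_j/I_{j,1}$. Bars denote residue classes. Construction. Step 0: $B_0=A[z]$, so $B_0/fB_0=\overline A[\overline z]$ is a polynomial ring; one has $\overline I_{0,1}\ne(0)$. Choose $g=g_0\in I_{0,1}$ whose image generates the extension of $\overline I_{0,1}$ to $Q(\overline A)[\overline z]$; write $g=f^{\ell_0}y_1$ with $\ell_0\ge1$, $y_1\in B\setminus fB$;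 put $B_1=B_0[f^{-\ell_0}I_{0,\ell_0}]$. Step $j\ge1$: if $I_{j,1}=fB_j$, then $B_j=B$ and the construction stops. If $I_{j,1}\supsetneq fB_j$, then the localization of $B_j/fB_j$ with respect to $B_{j-1}\setminus I_{j-1,1}$ is the polynomial ring $Q(\overline B_{j-1})[\overline y_j]$; choose $g_j\in I_{j,1}$ whose image generates the extension of $\overline I_{j,1}$ to this ring; write $g_j=f^{\ell_j}y_{j+1}$ with $\ell_j\ge1$, $y_{j+1}\in B\setminus fB$; put $B_{j+1}=B_j[f^{-\ell_j}I_{j,\ell_j}]$. *)

(* Defs.v *)
From HB Require Import structures.
From mathcomp Require Import all_boot all_order all_algebra.
From mathcomp Require Import boolp classical_sets reals complex fraction.

Set Implicit Arguments.
Unset Strict Implicit.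
Unset Printing Implicit Defensive.
Import Order.TTheory GRing.Theory Num.Theory.
Local Open Scope classical_set_scope.
Local Open Scope ring_scope.

#[short(type="domAlgType")]
HB.structure Definition DomAlgebra (K : nzRingType) :=
  {T of GRing.IntegralDomain T & GRing.ComUnitAlgebra K T}.

Section Rings.
Variable T : comNzRingType.
Implicit Types (R J S I X : set T) (h x y : T).

Definition subring R : Prop := GRing.subring_closed (mem R).

(* R[X]: the subring generated by R and X. It is a C-subalgebra as soon as R
   contains the constants. *)
Definition adjoin R X : set T := smallest subring (R `|` X).

Definition principal R x : set T := [set x * r | r in R].

Definition prime_in R x : Prop :=
  [/\ R x, x <> 0, ~ (exists2 y, R y & x * y = 1) &
      forall a b, R a -> R b -> principal R x (a * b) ->
        principal R x a \/ principal R x b].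

(* The localization S^-1 (R / J), for a subring R, an ideal J of R and a
   multiplicative subset S of R: the pair (r, s) with r in R and s in S stands
   for the fraction of the residue classes of r and s, and loc_eq is the
   equality of such fractions. *)
Definition loc_eq J S (u v : T * T) : Prop :=
  exists2 t, S t & J (t * (v.2 * u.1 - u.2 * v.1)).

(* The ideal of S^-1 (R / J) extended from the image of the ideal I of R in
   R / J, i.e. the fractions equal to some a / s with a in I and s in S. *)
Definition loc_ext R J S I : set (T * T) :=
  [set u | [/\ R u.1, S u.2 &
     exists a s, [/\ I a, S s & loc_eq J S u (a, s)]]].

End Rings.

Section Domains.
Variable T : idomainType.

Definition irreducible_elt (x : T) : Prop :=
  [/\ x <> 0, x \isn't a GRing.unit &
      forall a b, x = a * b -> a \is a GRing.unit \/ b \is a GRing.unit].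

Definition associate (x y : T) : Prop :=
  exists2 u, u \is a GRing.unit & y = u * x.

Definition factorial_domain : Prop :=
  (forall x : T, x <> 0 -> x \isn't a GRing.unit ->
     exists s : seq T, (forall q, q \in s -> irreducible_elt q) /\
       x = \prod_(q <- s) q) /\
  (forall s t : seq T,
     (forall q, q \in s -> irreducible_elt q) ->
     (forall q, q \in t -> irreducible_elt q) ->
     \prod_(q <- s) q = \prod_(q <- t) q ->
     exists t' : seq T, [/\ perm_eq t t', size s = size t' &
       forall i, (i < size s)%N -> associate s`_i t'`_i]).

(* R[h^-1 I]; since R is a subring of T, Q(R) is a subfield of Q(T), and the
   generated subring can be taken in the latter. *)
Definition affine_modification (R : set T) (h : T) (I : set T) :
    set {fraction T} :=
  adjoin [set tofrac r | r in R] [set tofrac a / tofrac h | a in I].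

End Domains.

Section Algebras.
Variables (K : fieldType) (B : domAlgType K).
Implicit Types (R : set B) (d : {linear B -> B}).

Definition fg_algebra R : Prop :=
  exists s : seq B, R = adjoin [set k%:A | k in [set: K]] [set` s].

Definition locally_nilpotent_derivation d : Prop :=
  (forall x y, d (x * y) = d x * y + x * d y) /\
  (forall x, exists n, iter n d x = 0).

Definition irreducible_derivation d : Prop :=
  forall b, range d `<=` principal setT b -> b \is a GRing.unit.

Definition kernel d : set B := [set x | d x = 0].

End Algebras.

Section Construction.
Variable T : idomainType.
Implicit Types (A R S : set T) (f g y z : T).

(* I_{j,k}, for R = B_j *)
Definition Iadic f R k : set T := R `&` principal setT (f ^+ k).

(* One step from R = B_j to R' = B_{j+1}, the generator g being taken in
   S^-1 (R / fR). *)
Definition modification_step f R S g (l : nat) y (R' : set T) : Prop :=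
  [/\ Iadic f R 1 g,
      loc_ext R (principal R f) S (principal R g)
        = loc_ext R (principal R f) S (Iadic f R 1),
      [/\ (0 < l)%N, g = f ^+ l * y & ~ principal setT f y] &
      [set tofrac r | r in R'] = affine_modification R (f ^+ l) (Iadic f R l)].

(* Bs is the sequence of the B_j, with choices g_j = g j, l_j = l j and
   y_{j+1} = y j.+1. The ring Q(A/fA)[z] of the first step is the localization
   of A[z]/fA[z] with respect to the nonzero elements of A/fA, i.e. the classes
   of the elements of A \ fA. A construction that stops at B_j is continued by
   B_{j+1} = B_j. *)
Definition modification_sequence A f z (Bs : nat -> set T)
    (g : nat -> T) (l : nat -> nat) (y : nat -> T) : Prop :=
  [/\ Bs 0 = adjoin A [set z],
      modification_step f (Bs 0) (A `\` principal A f)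
        (g 0) (l 0) (y 1) (Bs 1) &
      forall j, (0 < j)%N ->
        (principal (Bs j) f `<` Iadic f (Bs j) 1 ->
           modification_step f (Bs j) (Bs j.-1 `\` Iadic f (Bs j.-1) 1)
             (g j) (l j) (y j.+1) (Bs j.+1)) /\
        (Iadic f (Bs j) 1 = principal (Bs j) f -> Bs j.+1 = Bs j)].

End Construction.

(* Main.v *)
Require Import Defs.
From mathcomp Require Import all_boot all_order all_algebra.
From mathcomp Require Import boolp classical_sets reals complex fraction.

Set Implicit Arguments.
Unset Strict Implicit.
Unset Printing Implicit Defensive.
Import Order.TTheory GRing.Theory Num.Theory.
Local Open Scope classical_set_scope.
Local Open Scope ring_scope.

(** Two facts give the theorem.

    First, B and A[z] agree after inverting f: z / f^p is a slice of the
    derivation over A[1/f], and subtracting from b its leading Taylor term in z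
    lowers the order of nilpotency, so every b in B has some f^N b in A[z]
    ([clear_denominators]).

    Secondly, each step of the construction divides by f everything that can be
    divided: if r is in B and f r is in B_j, then r is in B_(j+1)
    ([modification_sequence_div]). When the construction has stopped,
    f r lies in I_(j,1) = f B_j. Otherwise f^(l_j) r lies in I_(j,l_j), because
    l_j >= 1, and r = f^(l_j) r / f^(l_j) is one of the generators of B_(j+1).

    Hence f^N b in B_0 implies b in B_N. As B is a finitely generated algebra,
    one N serves for all its generators at once, and B_N = B. *)

(** * Subrings given as sets *)

Section Subrings.
Variable T : comNzRingType.
Implicit Types (R X : set T) (x y : T).

Lemma subring1 R : subring R -> R 1.
Proof. by case=> /set_mem. Qed.

Lemma subringB R x y : subring R -> R x -> R y -> R (x - y).
Proof. by case=> _ RB _ /mem_set Rx /mem_set Ry; apply/set_mem/RB. Qed.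

Lemma subringM R x y : subring R -> R x -> R y -> R (x * y).
Proof. by case=> _ _ RM /mem_set Rx /mem_set Ry; apply/set_mem/RM. Qed.

Lemma subringD R x y : subring R -> R x -> R y -> R (x + y).
Proof.
move=> sR Rx Ry; rewrite -[y]opprK -[- y]sub0r -(subrr 1).
by apply: subringB => //; do 2?[apply: subringB => //]; apply: subring1.
Qed.

Lemma subringX R x n : subring R -> R x -> R (x ^+ n).
Proof.
move=> sR Rx; elim: n => [|n IHn]; first by rewrite expr0; apply: subring1.
by rewrite exprS; apply: subringM.
Qed.

Lemma subring_intro R :
  R 1 -> (forall x y, R x -> R y -> R (x - y)) ->
  (forall x y, R x -> R y -> R (x * y)) -> subring R.
Proof.
move=> R1 RB RM; split=> [|x y|x y]; first exact: mem_set.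
  by move=> /set_mem Rx /set_mem Ry; apply/mem_set/RB.
by move=> /set_mem Rx /set_mem Ry; apply/mem_set/RM.
Qed.

Lemma subring_adjoin R X : subring (adjoin R X).
Proof.
apply: subring_intro => [S [sS _]|x y Rx Ry S RS|x y Rx Ry S RS].
- exact: subring1.
- by have [sS _] := RS; apply: subringB => //; [apply: Rx|apply: Ry].
- by have [sS _] := RS; apply: subringM => //; [apply: Rx|apply: Ry].
Qed.

Lemma sub_adjoinl R X : R `<=` adjoin R X.
Proof. by move=> x Rx S [_]; apply; left. Qed.

Lemma sub_adjoinr R X : X `<=` adjoin R X.
Proof. by move=> x Xx S [_]; apply; right. Qed.

Lemma adjoin_sub R X S : subring S -> R `<=` S -> X `<=` S -> adjoin R X `<=` S.
Proof. by move=> sS RS XS x; apply; split=> // u [/RS|/XS]. Qed.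

End Subrings.

(** * The modification steps *)

Section Modifications.
Variable T : idomainType.
Implicit Types (A R S : set T) (f z r : T).

Lemma tofrac_image_inj R R' f l S g y r : modification_step f R S g l y R' ->
  affine_modification R (f ^+ l) (Iadic f R l) (tofrac r) -> R' r.
Proof. by case=> _ _ _ <- [r' R'r' /eqP]; rewrite tofrac_eq => /eqP <-. Qed.

Lemma modification_step_sub f R S g l y R' :
  modification_step f R S g l y R' -> R `<=` R'.
Proof.
by move=> step r Rr; apply: (tofrac_image_inj step); apply: sub_adjoinl; exists r.
Qed.

Lemma modification_step_subring f R S g l y R' :
  modification_step f R S g l y R' -> subring R'.
Proof.
move=> step.
have eqR' r : R' r <-> affine_modification R (f ^+ l) (Iadic f R l) (tofrac r).
  split; last exact: tofrac_image_inj step.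
  by have [_ _ _ <-] := step; exists r.
have sM := subring_adjoin [set tofrac r | r in R]
  [set tofrac a / tofrac (f ^+ l) | a in Iadic f R l].
apply: subring_intro => [|x x' /eqR' Mx /eqR' Mx'|x x' /eqR' Mx /eqR' Mx'];
  apply/eqR'.
- by rewrite tofrac1; exact: subring1 sM.
- by rewrite tofracB; exact: subringB sM Mx Mx'.
- by rewrite tofracM; exact: subringM sM Mx Mx'.
Qed.

(** Dividing by f alone is a case of dividing by f^l: the missing factor
    f^(l-1) can be supplied from R. *)
Lemma modification_step_div f R S g l y R' r : subring R -> R f -> f <> 0 ->
  modification_step f R S g l y R' -> R (f * r) -> R' r.
Proof.
move=> sR Rf /eqP f0 step Rfr; apply: (tofrac_image_inj step).
have [_ _ [l0 _ _] _] := step.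
apply: sub_adjoinr; exists (f ^+ l * r).
  split; last by exists r.
  by rewrite -(prednK l0) exprSr -mulrA; apply: subringM => //; apply: subringX.
by rewrite tofracM mulrAC divff ?mul1r // tofrac_eq0 expf_neq0.
Qed.

Section Sequence.
Variables (A : set T) (f z : T) (Bs : nat -> set T).
Variables (g : nat -> T) (l : nat -> nat) (y : nat -> T).
Hypothesis seqBs : modification_sequence A f z Bs g l y.
Hypotheses (Af : A f) (f0 : f <> 0).

(** A step of the sequence either is a modification or changes nothing, the
    latter only when B_j is already closed under division by f in B. *)
Lemma modification_sequence_step j : subring (Bs j) -> Bs j f ->
  [/\ subring (Bs j.+1), Bs j `<=` Bs j.+1 &
      forall r, Bs j (f * r) -> Bs j.+1 r].
Proof.
move=> sBj Bjf; have [_ step0 stepS] := seqBs.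
have stepP S R' : modification_step f (Bs j) S (g j) (l j) (y j.+1) R' ->
    [/\ subring R', Bs j `<=` R' & forall r, Bs j (f * r) -> R' r].
  move=> step; split; first exact: modification_step_subring step.
    exact: modification_step_sub step.
  by move=> r; apply: modification_step_div step.
case: j => [|j] in sBj Bjf stepP *; first exact: stepP step0.
have [stepj stopj] := stepS j.+1 isT.
have principal_sub : principal (Bs j.+1) f `<=` Iadic f (Bs j.+1) 1.
  by move=> _ [r Br <-]; split; [apply: subringM|exists r].
have [eqI|neqI] := EM (Iadic f (Bs j.+1) 1 = principal (Bs j.+1) f); last first.
  by apply/stepP/stepj; rewrite properEneq; split=> //; apply/eqP=> /esym.
rewrite (stopj eqI); split=> // r Bfr.
have : Iadic f (Bs j.+1) 1 (f * r) by split=> //; exists r.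
by rewrite eqI => -[r' Br' /(mulfI (introN eqP f0)) <-].
Qed.

Lemma modification_sequence_subring j : subring (Bs j) /\ A `<=` Bs j.
Proof.
elim: j => [|j [sBj ABj]]; last first.
  have [sB subB _] := modification_sequence_step sBj (ABj _ Af).
  by split=> // a /ABj /subB.
have [-> _ _] := seqBs.
by split; [apply: subring_adjoin|apply: sub_adjoinl].
Qed.

Lemma modification_sequence_mono i j : (i <= j)%N -> Bs i `<=` Bs j.
Proof.
move=> /subnK <-; elim: (j - i)%N => // k IHk r /IHk.
have [sB AB] := modification_sequence_subring (k + i).
by have [_ subB _] := modification_sequence_step sB (AB _ Af); apply: subB.
Qed.

Lemma modification_sequence_div j r : Bs j (f * r) -> Bs j.+1 r.
Proof.
have [sB AB] := modification_sequence_subring j.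
by have [_ _ divB] := modification_sequence_step sB (AB _ Af); apply: divB.
Qed.

Lemma modification_sequence_divX n r : Bs 0 (f ^+ n * r) -> Bs n r.
Proof.
elim: n r => [|n IHn] r; first by rewrite expr0 mul1r.
by rewrite exprSr -mulrA => /IHn /modification_sequence_div.
Qed.

End Sequence.
End Modifications.

(** * Local slices *)

Section LocalSlice.
Variables (K : fieldType) (B : domAlgType K) (d : {linear B -> B}).
Hypothesis dM : forall x y, d (x * y) = d x * y + x * d y.

Lemma derivation_const k : kernel d (k%:A).
Proof.
rewrite /kernel /= linearZ /=; suff -> : d 1 = 0 by rewrite scaler0.
by apply: (addrI (d 1)); rewrite addr0 -{3}[1]mulr1 dM mulr1 mul1r.
Qed.

Lemma kernel_subring : subring (kernel d).
Proof.
apply: subring_intro => [|x y|x y]; rewrite /kernel /=.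
- by have := derivation_const 1; rewrite scale1r.
- by move=> dx dy; rewrite linearB dx dy subrr.
- by move=> dx dy; rewrite dM dx dy mul0r mulr0 addr0.
Qed.

Lemma kernel_natr n : kernel d n%:R.
Proof. by have := derivation_const n%:R; rewrite scaler_nat. Qed.

Lemma iter_derivation_kernel n a x : kernel d a ->
  iter n d (a * x) = a * iter n d x.
Proof. by move=> da; elim: n => //= n ->; rewrite dM da mul0r add0r. Qed.

Lemma iter_derivationB n x y : iter n d (x - y) = iter n d x - iter n d y.
Proof. by elim: n => //= n ->; rewrite linearB. Qed.

Section Slice.
Variables z c : B.
Hypotheses (dz : d z = c) (dc : d c = 0).

Lemma derivation_sliceX n : d (z ^+ n.+1) = n.+1%:R * c * z ^+ n.
Proof.
elim: n => [|n IHn]; first by rewrite expr1 dz mul1r mulr1.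
rewrite exprS dM dz IHn mulrCA -exprS -mulrDl.
by rewrite -{1}[c]mul1r -mulrDl nat1r.
Qed.

Lemma iter_derivation_sliceX n : iter n d (z ^+ n) = n`!%:R * c ^+ n.
Proof.
elim: n => [|n IHn]; first by rewrite fact0 mulr1.
rewrite iterSr derivation_sliceX iter_derivation_kernel ?IHn; last first.
  by apply: (subringM kernel_subring) => //; apply: kernel_natr.
by rewrite factS natrM exprS mulrACA.
Qed.

End Slice.

(** With a = d^n b, the element n! f^(p n) b - a z^n is killed by d^n, which
    allows an induction on the order of nilpotency of b. *)
Lemma clear_denominators f z p n b : (forall n, n.+1%:R != 0 :> K) ->
  kernel d f -> d z = f ^+ p -> iter n d b = 0 ->
  exists N, adjoin (kernel d) [set z] (f ^+ N * b).
Proof.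
move=> char0 Af dz.
have sA := kernel_subring.
have Ac : kernel d (f ^+ p) by apply: subringX.
have sAz := subring_adjoin (kernel d) [set z].
have AAz a : kernel d a -> adjoin (kernel d) [set z] a by apply: sub_adjoinl.
elim: n b => [|n IHn] b.
  by move=> /= ->; exists 0%N; rewrite mulr0; apply: AAz; apply: raddf0.
move=> db; have Aa : kernel d (iter n d b) by [].
have AnX : kernel d (n`!%:R * (f ^+ p) ^+ n).
  by apply: subringM => //; [apply: kernel_natr|apply: subringX].
have [|N AzN] := IHn (n`!%:R * (f ^+ p) ^+ n * b - iter n d b * z ^+ n).
  rewrite iter_derivationB !iter_derivation_kernel //.
  by rewrite (iter_derivation_sliceX dz) // mulrC subrr.
have nfact0 : n`!%:R != 0 :> K by rewrite -(prednK (fact_gt0 n)).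
exists (N + p * n)%N.
have -> : f ^+ (N + p * n) * b = (n`!%:R^-1 : K)%:A *
    (f ^+ N * (n`!%:R * (f ^+ p) ^+ n * b - iter n d b * z ^+ n)
     + f ^+ N * (iter n d b * z ^+ n)).
  rewrite -mulrDr subrK exprD exprM mulr_algl.
  by rewrite -!mulrA [_ * (_%:R * _)]mulrCA mulr_natl -scaler_nat scalerA mulVf // scale1r.
apply: (subringM sAz); first by apply: AAz; apply: derivation_const.
have AzX : adjoin (kernel d) [set z] (f ^+ N) by apply: AAz; apply: subringX.
apply: (subringD sAz) => //; apply: (subringM sAz) => //.
apply: (subringM sAz); first exact: AAz.
by apply: (subringX _ sAz); apply: sub_adjoinr.
Qed.

End LocalSlice.

(** * Termination *)

Theorem lemma3p4 (R : realType) (B : domAlgType R[i]) (d : {linear B -> B})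
    (f z : B) (p : nat)
    (Bs : nat -> set B) (g : nat -> B) (l : nat -> nat) (y : nat -> B) :
  factorial_domain B ->
  fg_algebra [set: B] ->
  locally_nilpotent_derivation d ->
  irreducible_derivation d ->
  fg_algebra (kernel d) ->
  prime_in (kernel d) f ->
  (0 < p)%N ->
  range d `&` kernel d = principal (kernel d) (f ^+ p) ->
  d z = f ^+ p ->
  modification_sequence (kernel d) f z Bs g l y ->
  exists nu : nat, (0 < nu)%N /\ Bs nu = [set: B].
Proof.
move=> _ [s genB] [dM dnil] _ _ [Af f0 _ _] _ _ dz seqBs.
have eventually b : exists N, Bs N b.
  have [n dnb] := dnil b.
  have char0 m : m.+1%:R != 0 :> R[i] by rewrite pnatr_eq0.
  have [N AzN] := clear_denominators dM char0 Af dz dnb.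
  exists N; apply: (modification_sequence_divX seqBs Af f0).
  by case: seqBs => ->.
have mono := modification_sequence_mono seqBs Af f0.
have [N sN] : exists N, [set` s] `<=` Bs N.
  elim: s {genB} => [|b s [N IHs]]; first by exists 0%N.
  have [M BMb] := eventually b; exists (maxn M N) => x /=.
  rewrite inE => /orP[/eqP ->|xs]; first exact: mono (leq_maxl M N) _ BMb.
  exact: mono (leq_maxr M N) _ (IHs _ xs).
exists N.+1; split=> //; apply/seteqP; split=> // b _.
apply: mono (leqnSn N) _ _.
have [sBN ABN] := modification_sequence_subring seqBs Af f0 N.
have : [set: B] b by []; rewrite genB; apply: adjoin_sub => //.
by move=> _ [k _ <-]; apply/ABN/derivation_const.
Qed.
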